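(* Let $f:X\to X$ be a continuous map of a compact metric space $(X,d)$ and let $\mu$ be an $f$-invariant ergodic Borel probability measure with positive metric entropy $h_\mu(f)>0$. Then for every $p\in X$ the stable class $W^s(p)=\{x\in X:\lim_{n\to\infty}d(f^n(x),f^n(p))=0\}$ satisfies $\mu(W^s(p))=0$.
   Context: A stable class of $f$ is a set of the form $W^s(p)$ for some $p\in X$. *)

(* Defs.v *)
From HB Require Import structures.
From mathcomp Require Import all_boot all_order all_algebra.
From mathcomp Require Import all_classical all_reals all_analysis.
Set Implicit Arguments. Unset Strict Implicit. Unset Printing Implicit Defensive.
Import Order.TTheory GRing.Theory Num.Theory.
Import numFieldNormedType.Exports.
Local Open Scope classical_set_scope.
Local Open Scope ring_scope.

(* X viewed as a pointed type (pointedness is only needed by the library's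
   generated-sigma-algebra construction; X is nonempty anyway since it
   carries a probability measure). *)
Definition pointed_metric {R : realType} (X : metricType R) (x0 : X) : Type := X.
Arguments pointed_metric {R} X x0.
HB.instance Definition _ (R : realType) (X : metricType R) (x0 : X) :=
  Choice.on (pointed_metric X x0).
HB.instance Definition _ (R : realType) (X : metricType R) (x0 : X) :=
  isPointed.Build (pointed_metric X x0) x0.

Notation borel_of X x0 :=
  (g_sigma_algebraType (@open X : set (set (pointed_metric X x0)))).

Section ks_entropy.
Context {R : realType} {d : measure_display} {T : measurableType d}.
Variables (mu : probability T R) (f : T -> T).

Definition is_meas_partition (k : nat) (P : 'I_k -> set T) : Prop :=
  [/\ (forall i, measurable (P i)),
      (forall i j, i != j -> P i `&` P j = set0) &
      \bigcup_(i in [set: 'I_k]) P i = [set: T]].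

(* The atom of the join  P v f^{-1}P v ... v f^{-(n-1)}P  with itinerary w. *)
Definition join_atom (k n : nat) (P : 'I_k -> set T) (w : {ffun 'I_n -> 'I_k}) :
  set T := [set x | forall j : 'I_n, P (w j) (iter j f x)].

(* Shannon entropy of the join, with the convention 0 log 0 = 0. *)
Definition join_entropy (k : nat) (P : 'I_k -> set T) (n : nat) : R :=
  - \sum_(w : {ffun 'I_n -> 'I_k})
      (fine (mu (join_atom P w)) * ln (fine (mu (join_atom P w)))).

Definition entropy_wrt (k : nat) (P : 'I_k -> set T) : R :=
  limn (fun n : nat => join_entropy P n / n%:R).

Definition ks_entropy : \bar R :=
  ereal_sup [set e | exists k (P : 'I_k -> set T),
                       is_meas_partition P /\ e = (entropy_wrt P)%:E].
End ks_entropy.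

Definition invariant_measure {R : realType} {d : measure_display}
  {T : measurableType d} (mu : probability T R) (f : T -> T) : Prop :=
  forall A : set T, measurable A -> mu (f @^-1` A) = mu A.

Definition ergodic_measure {R : realType} {d : measure_display}
  {T : measurableType d} (mu : probability T R) (f : T -> T) : Prop :=
  forall A : set T, measurable A -> f @^-1` A = A ->
    mu A = 0%E \/ mu A = 1%E.

Definition stable_class {R : realType} {X : metricType R} (f : X -> X) (p : X) :
  set X :=
  [set x | (fun n : nat => mdist (iter n f x) (iter n f p)) @ \oo --> (0 : R)].

(* Main.v *)
Require Import Defs.
From HB Require Import structures.
From mathcomp Require Import all_boot all_order all_algebra.
From mathcomp Require Import all_classical all_reals all_analysis.
From mathcomp Require Import lra.
Import Order.TTheory GRing.Theory Num.Theory.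
Import numFieldNormedType.Exports.
Local Open Scope classical_set_scope.
Local Open Scope ring_scope.

(* Suppose W = W^s(p) has positive measure. By recurrence some x in W has
   f^k(x) in W with k > 0, so d(f^(n+k)(p), f^n(p)) -> 0, and therefore
   d(f^(n+k)(y), f^n(y)) -> 0 for every y in W. Hence the invariant set of the
   points whose orbit visits {z | d(f^k(z), z) >= e} infinitely often misses W;
   by ergodicity it is null, and since its measure is at least that of the
   visited set, f^k = id almost everywhere. Then only boundedly many
   itineraries (the k-periodic ones) carry mass, so all entropies vanish. *)

(** * Recurrence and ergodicity for an invariant probability measure *)

Section invariant_measures.
Context {R : realType} {d : measure_display} {T : measurableType d}.
Implicit Types (mu : probability T R) (f : T -> T) (A : set T).

Lemma measurable_lim_sup_set (F : (set T)^nat) :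
  (forall n, measurable (F n)) -> measurable (lim_sup_set F).
Proof.
by move=> mF; apply: bigcapT_measurable => n; apply: bigcup_measurable.
Qed.

Lemma measurable_iter f n : measurable_fun setT f ->
  measurable_fun setT (iter n f).
Proof.
move=> mf; elim: n => [|n IHn]; first exact: measurable_id.
exact: (measurableT_comp mf IHn).
Qed.

Lemma measurable_iter_preimage f n A : measurable_fun setT f ->
  measurable A -> measurable (iter n f @^-1` A).
Proof.
by move=> mf mA; rewrite -[X in measurable X]setTI; exact: measurable_iter.
Qed.

Lemma measure_iter_preimage mu f n A : measurable_fun setT f ->
  invariant_measure mu f -> measurable A -> mu (iter n f @^-1` A) = mu A.
Proof.
move=> mf If mA; elim: n => // n IHn.
rewrite -[RHS]IHn -[RHS]If; last exact: measurable_iter_preimage.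
by congr (mu _); apply/seteqP; split => x /=; rewrite -iterSr.
Qed.

Definition visits_infinitely_often f A : set T :=
  lim_sup_set (fun n => iter n f @^-1` A).

Lemma measurable_visits f A : measurable_fun setT f -> measurable A ->
  measurable (visits_infinitely_often f A).
Proof.
by move=> mf mA; apply: measurable_lim_sup_set => n;
  exact: measurable_iter_preimage.
Qed.

(** Shifting time by one does not affect visiting infinitely often. The invariance is exact, not
    merely almost everywhere, which is the form that [ergodic_measure] asks for. *)
Lemma preimage_visits f A :
  f @^-1` visits_infinitely_often f A = visits_infinitely_often f A.
Proof.
apply/seteqP; split => x Vx n _.
- have [j /= nj Aj] := Vx n I; exists j.+1; first exact: leqW.
  by rewrite /= -iterS iterSr.
(* Asking for a visit after time [n.+1] rules out time 0, so the visit time has a predecessor. *)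
- have [[//|j] /= nj Aj] := Vx n.+1 I; exists j => //.
  by rewrite /= -iterSr.
Qed.

(** The limsup set is the decreasing limit of the tail unions from [n] on. Each tail contains the
    [n]-th preimage of [A], of measure [mu A], and [mu] is finite, so the bound passes to the
    limit. *)
Lemma le_measure_visits mu f A : measurable_fun setT f ->
  invariant_measure mu f -> measurable A ->
  (mu A <= mu (visits_infinitely_often f A))%E.
Proof.
move=> mf If mA.
have mF n : measurable (iter n f @^-1` A) by exact: measurable_iter_preimage.
have mU n : measurable (\bigcup_(k >= n) iter k f @^-1` A).
  exact: bigcup_measurable.
have cU : mu (\bigcup_(k >= n) iter k f @^-1` A) @[n --> \oo] -->
    mu (visits_infinitely_often f A).
  apply: lim_sup_set_cvg => //.
  by apply: (le_lt_trans (probability_le1 _ _)); rewrite ?ltry.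
rewrite -(cvg_lim _ cU)//; apply: lime_ge; first by apply/cvg_ex; eexists; exact: cU.
apply: nearW => n; rewrite -(measure_iter_preimage mu f n A)//.
by apply: le_measure; rewrite ?inE// => x Ax; exists n => /=.
Qed.

(** A weak Poincaré recurrence: some orbit visits [A] infinitely often, and two of its visits, at
    times [i < j], give the point and the return time [j - i]. *)
Lemma recurrent_point mu f A : measurable_fun setT f ->
  invariant_measure mu f -> measurable A -> mu A <> 0%E ->
  exists x k, A x /\ A (iter k.+1 f x).
Proof.
move=> mf If mA A0.
have [x Vx] : visits_infinitely_often f A !=set0.
  apply/set0P/negP => /eqP V0; apply: A0.
  apply/eqP; rewrite -measure_le0 -(measure0 mu) -V0.
  exact: le_measure_visits.
have [i _ /= Ai] := Vx 0 I; have [j /= ij Aj] := Vx i.+1 I.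
exists (iter i f x), (j - i.+1)%N; split => //.
by rewrite -iterS -iterD addSnnS subnK.
Qed.

(** The visiting set is invariant, so it has measure 0 or 1. Measure 1 would make [B], which lies in
    its complement, null; measure 0 bounds [mu A]. *)
Lemma ergodic_eventually_avoided mu f A B : measurable_fun setT f ->
  invariant_measure mu f -> ergodic_measure mu f ->
  measurable A -> measurable B -> mu B <> 0%E ->
  B `&` visits_infinitely_often f A = set0 -> mu A = 0%E.
Proof.
move=> mf If Ef mA mB B0 BV.
have mV := measurable_visits f A mf mA.
apply/eqP; rewrite -measure_le0; apply: (le_trans (le_measure_visits mu f A mf If mA)).
case: (Ef _ mV (preimage_visits f A)) => [->//|V1].
exfalso; apply: B0; apply/eqP; rewrite -measure_le0.
have : (mu B <= mu (~` visits_infinitely_often f A))%E.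
  apply: le_measure; rewrite ?inE//; first exact: measurableC.
  exact/disjoints_subset.
by move/le_trans; apply; rewrite probability_setC// V1 subee.
Qed.

End invariant_measures.

(** * Vanishing entropy of almost everywhere periodic maps *)

Lemma oppr_xlnx_itv01 {R : realType} (x : R) : 0 <= x <= 1 -> 0 <= - (x * ln x) <= 1.
Proof.
move=> /andP[x0 x1]; rewrite -mulrN; apply/andP; split.
  by rewrite mulr_ge0// oppr_ge0 ln_le0.
move: x0; rewrite le_eqVlt => /predU1P[<-|x0]; first by rewrite mul0r.
rewrite -lnV ?posrE//.
(* Multiplying by [x] gives [- x ln x <= 1 - x], from which the crude bound 1 follows. *)
have : ln (x^-1) <= x^-1 - 1.
  rewrite -[X in ln X](subrK 1) addrC; apply: le_ln1Dx.
  by rewrite ltrBrDr addNr invr_gt0.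
move=> /(ler_wpM2l (ltW x0)) /le_trans; apply.
by rewrite mulrBr mulfV ?gt_eqF// mulr1 gerBl ltW.
Qed.

Lemma iter_periodic {T : Type} (g : T -> T) n j x : iter n g x = x ->
  iter j g x = iter (j %% n) g x.
Proof.
move=> gx; rewrite {1}(divn_eq j n) addnC iterD.
by congr iter; elim: (j %/ n)%N => // m IHm; rewrite mulSn iterD IHm.
Qed.

Section entropy_periodic.
Context {R : realType} {d : measure_display} {T : measurableType d}.
Variables (mu : probability T R) (f : T -> T) (k : nat).
Hypothesis mf : measurable_fun setT f.
Hypothesis mk : measurable [set x | iter k.+1 f x <> x].
Hypothesis fk : mu [set x | iter k.+1 f x <> x] = 0%E.

Variables (q : nat) (P : 'I_q -> set T).
Hypothesis PP : is_meas_partition P.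

Lemma measurable_join_atom n (w : {ffun 'I_n -> 'I_q}) :
  measurable (join_atom f P w).
Proof.
have -> : join_atom f P w =
    \bigcap_(j in [set: 'I_n]) (iter j f @^-1` P (w j)).
  by apply/seteqP; split => x /= H => [j _|j]; apply: H.
apply: fin_bigcap_measurable => // j _.
by apply: measurable_iter_preimage => //; case: PP.
Qed.

Definition periodic_word n (u : {ffun 'I_k.+1 -> 'I_q}) : {ffun 'I_n -> 'I_q} :=
  [ffun j : 'I_n => u (inord (j %% k.+1))].

(** Since the cells are disjoint, a point of the atom has [w] as its only itinerary. If
    [iter k.+1 f] fixed it, [w] would be periodic; hence the atom lies in the null set of [fk]. *)
Lemma join_atom_null n (w : {ffun 'I_n -> 'I_q}) :
  w \notin codom (periodic_word n) -> mu (join_atom f P w) = 0%E.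
Proof.
move=> wN; case: PP => mP dP cP; apply/eqP; rewrite -measure_le0 -fk.
have itin x : exists i, P i x.
  by have : [set: T] x by []; rewrite -cP => -[i _ Pi]; exists i.
apply: le_measure; rewrite ?inE//; first exact: measurable_join_atom.
move=> x wx fkx; move/negP: wN; apply; apply/codomP.
have [g Pg] := choice itin.
exists [ffun i : 'I_k.+1 => g (iter i f x)]; apply/ffunP => j.
rewrite !ffunE inordK ?ltn_mod// -(iter_periodic _ _ _ _ fkx).
apply/eqP/negPn/negP => /dP wg.
by suff : set0 (iter j f x) by []; rewrite -wg; split; [exact: wx|exact: Pg].
Qed.

(** Only periodic words contribute, each at most 1, and they are determined by their first [k.+1]
    letters. The bound is therefore independent of [n]. *)
Lemma join_entropy_bounded n :
  0 <= join_entropy mu f P n <= #|{ffun 'I_k.+1 -> 'I_q}|%:R.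
Proof.
rewrite /join_entropy -sumrN.
have mu01 A : measurable A -> 0 <= fine (mu A) <= 1.
  move=> mA; rewrite fine_ge0//= -lee_fin fineK ?fin_num_measure//.
  exact: probability_le1.
apply/andP; split.
  apply: sumr_ge0 => w _.
  by have /andP[] := oppr_xlnx_itv01 _ (mu01 _ (measurable_join_atom _ w)).
apply: (@le_trans _ _ (\sum_(w in codom (periodic_word n)) (1 : R))).
  rewrite [leRHS]big_mkcond/=; apply: ler_sum => w _; case: ifPn => [_|wN].
    by have /andP[] := oppr_xlnx_itv01 _ (mu01 _ (measurable_join_atom _ w)).
  by rewrite join_atom_null// mul0r oppr0.
rewrite sumr_const ler_nat; exact: leq_image_card.
Qed.

Lemma entropy_wrt_eq0 : entropy_wrt mu f P = 0.
Proof.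
apply: cvg_lim => //.
set C : R := #|{ffun 'I_k.+1 -> 'I_q}|%:R.
(* The shift skips the division by 0 at [n = 0] and matches [harmonic n], which is [1 / (n + 1)]. *)
rewrite -(cvg_shiftS (fun n => join_entropy mu f P n / n%:R)).
apply: (@squeeze_cvgr _ _ _ _ (cst 0) (fun n => C * harmonic n)).
- apply: nearW => n; have /andP[h0 hC] := join_entropy_bounded n.+1.
  by rewrite divr_ge0//= ler_wpM2r// invr_ge0.
- exact: cvg_cst.
- by rewrite -(mulr0 C); apply: cvgMl_tmp; exact: cvg_harmonic.
Qed.

End entropy_periodic.

Lemma ks_entropy_periodic_le0 {R : realType} {d : measure_display}
    {T : measurableType d} (mu : probability T R) (f : T -> T) k :
  measurable_fun setT f -> measurable [set x | iter k.+1 f x <> x] ->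
  mu [set x | iter k.+1 f x <> x] = 0%E -> (ks_entropy mu f <= 0)%E.
Proof.
move=> mf mk fk; apply: ge_ereal_sup => _ [q [P [PP ->]]].
by rewrite (@entropy_wrt_eq0 _ _ _ _ _ k).
Qed.

(** * Stable classes of a continuous map *)

Section metric_dynamics.
Context {R : realType} {X : metricType R}.
Implicit Types (f : X -> X) (p x y : X) (e : R).

Lemma open_mdist_lt (u v : X -> X) (e : R) : continuous u -> continuous v ->
  open [set x | mdist (u x) (v x) < e].
Proof.
move=> cu cv; rewrite openE => x /= xe.
(* Half of the slack: [u] and [v] may each move by less than [r]. *)
pose r := (e - mdist (u x) (v x)) / 2.
have r0 : 0 < r by rewrite divr_gt0// subr_gt0.
have ur := metricType_numDomainType.cvgr_dist_lt (cu x) r0.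
have vr := metricType_numDomainType.cvgr_dist_lt (cv x) r0.
rewrite /interior/=; near=> y => /=.
have -> : e = r + mdist (u x) (v x) + r.
  by rewrite addrAC /r -splitr subrK.
apply: (le_lt_trans (metric_triangle _ (v x) _)).
apply: ltrD; last by near: y; exact: vr.
apply: (le_lt_trans (metric_triangle _ (u x) _)).
by rewrite ltrD2r metric_sym; near: y; exact: ur.
Unshelve. all: by end_near. Qed.

Lemma continuous_iter f n : continuous f -> continuous (iter n f).
Proof.
move=> cf; elim: n => [|n IHn] x; first exact: cvg_id.
exact: (continuous_comp (IHn x) (cf _)).
Qed.

Lemma stable_classP f p x : stable_class f p x <->
  forall e : R, 0 < e ->
    \forall n \near \oo, mdist (iter n f x) (iter n f p) < e.
Proof.
rewrite /stable_class/=; split.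
- move=> /cvgr0Pnorm_lt xp e /xp; apply: filterS => n.
  by rewrite ger0_norm// mdist_ge0.
- move=> xp; apply/cvgr0Pnorm_lt => e /xp; apply: filterS => n.
  by rewrite ger0_norm// mdist_ge0.
Qed.

(** Testing convergence only at the radii [1 / (m + 1)] makes the union countable, which yields
    measurability. *)
Lemma stable_classC f p : ~` stable_class f p =
  \bigcup_m lim_sup_set (fun n =>
    [set x | m.+1%:R^-1 <= mdist (iter n f x) (iter n f p)]).
Proof.
apply/seteqP; split => x /=.
- move=> xNp; apply: contrapT => xNU; apply: xNp; apply/stable_classP => e e0.
  have [m me] : exists m, m.+1%:R^-1 < e.
    exists (Num.Def.trunc e^-1); rewrite invf_plt ?posrE//.
    exact: truncnS_gt.
  apply: contrapT => ne; apply: xNU; exists m => // n _.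
  apply: contrapT => nm; apply: ne; exists n => // j /= nj.
  apply: lt_trans me; rewrite ltNge; apply/negP => mj.
  by apply: nm; exists j.
- move=> [m _ xm] /stable_classP /(_ m.+1%:R^-1).
  rewrite invr_gt0 ltr0n => /(_ isT) [n _ nm].
  have [j /= nj] := xm n I; rewrite leNgt => /negP; apply.
  exact: nm.
Qed.

(** Four steps of size [e / 4] along the chain [f^(n+k) y], [f^(n+k) p], [f^(n+k) x = f^n (f^k x)],
    [f^n p], [f^n y]. *)
Lemma stable_class_almost_periodic f p k x y e :
  stable_class f p x -> stable_class f p (iter k f x) ->
  stable_class f p y -> 0 < e ->
  \forall n \near \oo, mdist (iter k f (iter n f y)) (iter n f y) < e.
Proof.
move=> /stable_classP xp /stable_classP kxp /stable_classP yp e0.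
have e4 : 0 < e / 4 by rewrite divr_gt0.
have shift (P : nat -> Prop) : (\forall n \near \oo, P n) ->
    \forall n \near \oo, P (n + k)%N.
  move=> [N _ PN]; exists N => // n /= Nn; apply: PN => /=.
  exact: leq_trans (leq_addr _ _).
have [yp_k xp_k] := (shift _ (yp _ e4), shift _ (xp _ e4)).
have [yp_0 kxp_0] := (yp _ e4, kxp _ e4).
near=> n.
have y1 : mdist (iter (n + k) f y) (iter (n + k) f p) < e / 4.
  by near: n; exact: yp_k.
have x1 : mdist (iter (n + k) f x) (iter (n + k) f p) < e / 4.
  by near: n; exact: xp_k.
have x2 : mdist (iter n f (iter k f x)) (iter n f p) < e / 4.
  by near: n; exact: kxp_0.
have y2 : mdist (iter n f y) (iter n f p) < e / 4 by near: n; exact: yp_0.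
rewrite -iterD in x2; rewrite -iterD addnC.
have t1 := metric_triangle (iter (n + k) f y) (iter (n + k) f p) (iter n f y).
have t2 := metric_triangle (iter (n + k) f p) (iter (n + k) f x) (iter n f y).
have t3 := metric_triangle (iter (n + k) f x) (iter n f p) (iter n f y).
rewrite (metric_sym _ (iter (n + k) f x)) in t2.
rewrite (metric_sym (iter n f p)) in t3.
lra.
Unshelve. all: by end_near. Qed.

End metric_dynamics.

(** * Borel measurability *)

Section borel_dynamics.
Context {R : realType} {X : metricType R} (x0 : X).

Lemma open_measurable_borel_of (A : set X) :
  open A -> measurable (A : set (borel_of X x0)).
Proof. by move=> oA; apply: sub_sigma_algebra. Qed.

Lemma continuous_measurable_borel_of (f : X -> X) : continuous f ->
  measurable_fun setT (f : borel_of X x0 -> borel_of X x0).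
Proof.
move=> /continuousP cf.
apply: (@measurability _ _ (borel_of X x0) (borel_of X x0) setT f (@open X)) => //.
move=> _ [A oA <-]; rewrite setTI; apply: open_measurable_borel_of; exact: cf.
Qed.

Lemma measurable_le_mdist (u v : X -> X) (e : R) :
  continuous u -> continuous v ->
  measurable ([set x | e <= mdist (u x) (v x)] : set (borel_of X x0)).
Proof.
move=> cu cv.
have -> : [set x | e <= mdist (u x) (v x)] =
    ~` [set x | mdist (u x) (v x) < e].
  by apply/seteqP; split => x /=; rewrite leNgt => /negP.
by apply: measurableC; apply: open_measurable_borel_of; exact: open_mdist_lt.
Qed.

Lemma measurable_stable_class (f : X -> X) (p : X) : continuous f ->
  measurable (stable_class f p : set (borel_of X x0)).
Proof.
move=> cf; rewrite -[stable_class f p]setCK; apply: measurableC.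
rewrite stable_classC; apply: bigcupT_measurable => m.
apply: measurable_lim_sup_set => n.
apply: (@measurable_le_mdist (iter n f) (cst (iter n f p))).
- exact: continuous_iter.
- by move=> x; exact: cvg_cst.
Qed.

End borel_dynamics.

Theorem theorem4p4 (R : realType) (X : metricType R) (x0 : X)
  (f : X -> X) (mu : probability (borel_of X x0) R) :
  compact [set: X] ->
  continuous f ->
  invariant_measure mu f ->
  ergodic_measure mu f ->
  (0 < ks_entropy mu f)%E ->
  forall p : X, mu (stable_class f p) = 0%E.
Proof.
move=> _ cf If Ef h0 p; apply: contrapT => W0.
have mf := continuous_measurable_borel_of x0 f cf.
have mW := measurable_stable_class x0 f p cf.
have [x [k [Wx Wkx]]] := recurrent_point mu f _ mf If mW W0.
(* The points that [iter k.+1 f] moves by at least [1 / (m + 1)]. Orbits starting in the stable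
   class eventually avoid each [D m], so ergodicity makes it null. *)
pose D m : set (borel_of X x0) :=
  [set z : X | m.+1%:R^-1 <= mdist (iter k.+1 f z) z].
have mD m : measurable (D m).
  apply: (@measurable_le_mdist _ _ _ (iter k.+1 f) id).
  - exact: continuous_iter.
  - by move=> z; exact: cvg_id.
have D0 m : mu (D m) = 0%E.
  apply: (ergodic_eventually_avoided mu f _ _ mf If Ef (mD m) mW W0).
  rewrite -subset0 => y [Wy Vy].
  have [|n _ nD] :=
    stable_class_almost_periodic f p k.+1 x y m.+1%:R^-1 Wx Wkx Wy.
    by rewrite invr_gt0.
  have [j nj Dj] := Vy n I; move: (nD j nj).
  by rewrite /= ltNge => /negP; apply; exact: Dj.
(* A countable union of null sets, so [iter k.+1 f] is the identity almost everywhere. *)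
have DE : \bigcup_m D m = [set z | iter k.+1 f z <> z].
  apply/seteqP; split => z /=.
  - move=> [m _ Dz] kz; move: Dz; rewrite /D/= kz mdistxx.
    by rewrite invr_le0 lern0.
  - move=> kz; have kz0 : 0 < mdist (iter k.+1 f z) z by rewrite mdist_gt0; exact/eqP.
    (* The Archimedean choice of [m]: [m + 1] exceeds the inverse of the displacement. *)
    exists (Num.Def.trunc (mdist (iter k.+1 f z) z)^-1) => //=.
    by rewrite /D/= invf_ple ?posrE// ltW// truncnS_gt.
move: h0; apply/negP; rewrite -leNgt.
apply: (ks_entropy_periodic_le0 mu f k mf); rewrite -DE.
- exact: bigcupT_measurable.
- apply: measure_negligible; first exact: bigcupT_measurable.
  by apply: negligible_bigcup => m; apply/negligibleP; [exact: mD|exact: D0].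
Qed.
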